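(* Let $p$ be a positive integer, let $\boldsymbol{\beta}=(\beta_0,\ldots,\beta_{p-1})$ be an alternate base of length $p$, and let $\delta=\prod_{i=0}^{p-1}\beta_i$. If $d_{\boldsymbol{\beta}^{(i)}}(1)$ is eventually periodic for all $i\in\{0,\ldots,p-1\}$, then $\delta$ is an algebraic integer and $\beta_i\in\mathbb{Q}(\delta)$ for all $i\in\{0,\ldots,p-1\}$.
   Context: An alternate base of length $p$ is a $p$-tuple $\boldsymbol\beta=(\beta_0,\ldots,\beta_{p-1})$ of real numbers greater than $1$. For all $n\in\mathbb Z$, $\beta_n=\beta_{n\bmod p}$ and $\boldsymbol\beta^{(n)}=(\beta_n,\ldots,\beta_{n+p-1})$. For $x\in[0,1]$, the $\boldsymbol\beta$-expansion $d_{\boldsymbol\beta}(x)=\varepsilon_0(x)\varepsilon_1(x)\varepsilon_2(x)\cdots$ is the infinite sequence of digits given by the greedy algorithm: $\varepsilon_0(x)=\lfloor\beta_0x\rfloor$, $r_0(x)=\beta_0x-\varepsilon_0(x)$, and for $n\ge1$, $\varepsilon_n(x)=\lfloor\beta_nr_{n-1}(x)\rfloor$, $r_n(x)=\beta_nr_{n-1}(x)-\varepsilon_n(x)$. The expansion $d_{\boldsymbol\beta^{(i)}}(1)$ is obtained by applying this to the alternate base $\boldsymbol\beta^{(i)}$ and $x=1$. An infinite word is eventually periodic if it is of the form $uv^\omega=uvvv\cdots$ with $u,v$ finite words and $v$ non-empty. *)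

(* Defs.v *)
From mathcomp Require Import all_boot all_order all_algebra.
From mathcomp Require Import reals.

Set Implicit Arguments.
Unset Strict Implicit.
Unset Printing Implicit Defensive.

Import Order.TTheory GRing.Theory Num.Theory.
Local Open Scope ring_scope.

Section AlternateBase.
Variables (R : realType) (p : nat).

Definition alternate_base (b : p.-tuple R) : Prop :=
  forall i : 'I_p, 1 < tnth b i.

(* Meaningful for 0 < p.  Only nonnegative indices occur below, hence nat
   instead of int. *)
Definition base_at (b : p.-tuple R) (n : nat) : R := b`_(n %% p).

Definition base_shift (b : p.-tuple R) (n : nat) : p.-tuple R :=
  [tuple base_at b (n + k) | k < p].

Fixpoint greedy_rem (b : p.-tuple R) (x : R) (n : nat) : R :=
  let y := base_at b n * (if n is m.+1 then greedy_rem b x m else x) in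
  y - (Num.floor y)%:~R.

Definition expansion (b : p.-tuple R) (x : R) (n : nat) : int :=
  Num.floor (base_at b n * (if n is m.+1 then greedy_rem b x m else x)).

End AlternateBase.

Section Words.
Variable T : Type.

(* The infinite word u v v v ... when v is nonempty; the default letter x0 is
   then never used. *)
Definition uv_omega (x0 : T) (u v : seq T) (n : nat) : T :=
  if (n < size u)%N then nth x0 u n
  else nth x0 v ((n - size u) %% size v).

Definition eventually_periodic (w : nat -> T) : Prop :=
  exists u v : seq T, (0 < size v)%N /\ w =1 uv_omega (w 0%N) u v.

End Words.

Definition algebraic_integer (R : realType) (x : R) : Prop :=
  integralOver (intr : int -> R) x.

(* Q(d) is the intersection of all subfields of R containing d; a subfield is
   a subset containing 1 and closed under subtraction and division, and
   therefore contains Q. *)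
Definition in_Qadjoin (R : realType) (d x : R) : Prop :=
  forall K : divringClosed R, d \in K -> x \in K.

(* Main.v *)
Require Import Defs.
From mathcomp Require Import all_boot all_order all_algebra.
From mathcomp Require Import perm reals.
From mathcomp Require Import ring lra zify.

Set Implicit Arguments.
Unset Strict Implicit.
Unset Printing Implicit Defensive.

Import Order.TTheory GRing.Theory Num.Theory.
Local Open Scope ring_scope.

(** Write x_m = 1 / (beta_0 ... beta_(m-1)), so that x_(m+p) = x_m / delta and
    beta_i = x_i / x_(i+1).  Both conclusions concern the row
    x = (x_0, ..., x_(p-1)), which turns out to be the unique normalized
    solution of a linear system over Z[delta].

    The system.  Let e_0 e_1 ... be the expansion of 1 in the base shifted by
    i, and T_n the remainder left before digit n is produced.  The greedy
    recursion telescopes to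
      T_n x_(i+n) = x_i - (e_0 x_(i+1) + ... + e_(n-1) x_(i+n)).
    For n = p K the left side is T_n x_i / delta^K.  Eventual periodicity of
    the digits forces T_(p K) = T_(p (L + K)) for some K, L > 0
    ([greedy_tail_return]): the difference of two remainders with equal future
    digits is multiplied by delta every p steps and yet stays bounded.
    Equating the two expressions of T x_i gives one linear equation for each i.
    After reducing indices modulo p, its coefficients are integer polynomials
    in delta; they form the matrix [period_mx].

    Integrality.  Equation i has degree L_i + K_i in delta, and that degree
    is reached only at x_i itself, with coefficient 1, and possibly at x_j with
    i < j < p, since an index that wraps around p costs a factor delta.  So
    the matrix of top coefficients is unitriangular and the determinant is
    monic ([det_period_mx_monic]).  It vanishes at delta because x is a nonzero
    solution.

    Membership in Q(delta).  All digits are nonnegative and each leading digit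
    is positive, so the system obeys a maximum principle of Perron-Frobenius
    type: a zero of a nonnegative solution spreads from i to i+1, hence all
    around the cycle.  Thus a solution of the equations i > 0 that vanishes at
    index 0 is null ([period_sol_eq0]).  Replacing equation 0 by the
    normalization x_0 = 1 therefore gives an invertible system with entries in
    Q(delta), so that x has entries in Q(delta) ([period_sol_in_divring]). *)

(** * Top coefficients of determinants of polynomial matrices *)

Lemma coefM_top (R : comNzRingType) (q r : {poly R}) (a b : nat) :
    (size q <= a.+1)%N -> (size r <= b.+1)%N ->
  (q * r)`_(a + b) = q`_a * r`_b.
Proof.
move=> sq sr; have lt_a : (a < (a + b).+1)%N by rewrite ltnS leq_addr.
rewrite coefM (bigD1 (Ordinal lt_a)) //= addKn big1 ?addr0 // => -[i /= lti].
rewrite -val_eqE /= => neq_ia; have [lt_ia|le_ai] := ltnP i a.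
  rewrite [r`_ _]nth_default ?mulr0 //; apply: leq_trans sr _; lia.
by rewrite [q`_ _]nth_default ?mul0r //; apply: leq_trans sq _; lia.
Qed.

Lemma coef_prod_top (R : comNzRingType) (n : nat) (F : 'I_n -> {poly R})
    (d : 'I_n -> nat) : (forall i, (size (F i) <= (d i).+1)%N) ->
  (size (\prod_i F i)%R <= (\sum_i d i).+1)%N
  /\ (\prod_i F i)`_(\sum_i d i) = \prod_i (F i)`_(d i).
Proof.
move=> szF.
pose top q a c := (size (q : {poly R}) <= a.+1)%N /\ q`_a = c.
apply: (big_rec3 top); first by rewrite /top size_poly1 coef1.
move=> i q a c _ [szq <-]; split; last by rewrite coefM_top.
apply: leq_trans (size_polyMleq _ _) _.
by move: szq (szF i); case: (size q) (size _) => [|?] [|?]; lia.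
Qed.

(** Every term of the Leibniz formula takes one entry from each column, so it
    has degree at most the sum of the column bounds, and taking the coefficient
    in that degree is multiplicative. *)
Lemma coef_det_top (R : comNzRingType) (n : nat) (A : 'M[{poly R}]_n)
    (d : 'I_n -> nat) : (forall i j, (size (A i j) <= (d j).+1)%N) ->
  (size (\det A) <= (\sum_j d j).+1)%N
  /\ (\det A)`_(\sum_j d j) = \det (\matrix_(i, j) (A i j)`_(d j)).
Proof.
move=> szA; rewrite -[\det A]det_tr -[\det (\matrix_(_, _) _)]det_tr.
have top (s : 'S_n) := @coef_prod_top R n (fun j => A^T j (s j)) d.
split.
  apply: leq_trans (size_sum _ _ _) _; apply/bigmax_leqP => s _.
  rewrite -signr_odd; case: odd_perm;
    rewrite ?expr0 ?expr1 ?mul1r ?mulN1r ?size_polyN;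
    by have [|//] := top s => j; rewrite mxE.
rewrite coef_sum; apply: eq_bigr => s _.
have [j|_ topE] := top s; first by rewrite mxE.
have {}topE : (\prod_i A^T i (s i))`_(\sum_i d i)
    = \prod_i (\matrix_(i, j) (A i j)`_(d j))^T i (s i).
  by rewrite topE; apply: eq_bigr => j _; rewrite !mxE.
rewrite -topE -signr_odd; case: odd_perm;
  by rewrite ?expr0 ?expr1 ?mul1r ?mulN1r ?coefN.
Qed.

Lemma det_monic_of_trig (R : comNzRingType) (n : nat) (A : 'M[{poly R}]_n)
    (d : 'I_n -> nat) : (forall i j, (size (A i j) <= (d j).+1)%N) ->
    (forall i j : 'I_n, (i < j)%N -> (A i j)`_(d j) = 0) ->
    (forall i, (A i i)`_(d i) = 1) ->
  \det A \is monic.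
Proof.
move=> szA trigA diagA; have [szD] := coef_det_top szA.
rewrite [RHS]det_trig; last first.
  by apply/is_trig_mxP => i j lt_ij; rewrite mxE trigA.
rewrite [RHS]big1 => [top1|i _]; last by rewrite mxE diagA.
have szE : size (\det A) = (\sum_j d j).+1.
  apply/eqP; rewrite eqn_leq szD /= ltnNge; apply: contra_eqN top1 => le_sz.
  by rewrite nth_default // eq_sym oner_eq0.
by rewrite monicE lead_coefE szE /= top1.
Qed.

(** * Linear systems over a subfield *)

Section Divring.
Variables (F : fieldType) (K : divringClosed F).

Lemma det_in_divring n (A : 'M[F]_n) : (forall i j, A i j \in K) -> \det A \in K.
Proof.
move=> AK; apply: rpred_sum => s _; apply: rpredM.
  by rewrite rpredX // rpredN rpred1.
by apply: rpred_prod => i _.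
Qed.

(** Cramer's rule: the inverse of A is rational in the entries of A. *)
Lemma solution_in_divring n (A : 'M[F]_n) (x : 'rV[F]_n) :
    A \in unitmx -> (forall i j, A i j \in K) ->
    (forall j, (x *m A) 0 j \in K) ->
  forall j, x 0 j \in K.
Proof.
move=> uA AK xAK j; rewrite -[x](mulmxK uA) mxE.
apply: rpred_sum => i _; apply: rpredM => //.
rewrite /invmx uA !mxE; apply: rpredM; first by rewrite rpredV det_in_divring.
rewrite /cofactor rpredM // ?rpredX ?rpredN ?rpred1 // det_in_divring // => k l.
by rewrite !mxE.
Qed.

Lemma horner_in_divring (q : {poly int}) (d : F) :
  d \in K -> (map_poly intr q).[d] \in K.
Proof.
move=> dK; rewrite horner_coef; apply: rpred_sum => i _.
by rewrite coef_map /= rpredM ?rpred_int ?rpredX.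
Qed.

End Divring.

(** * Greedy remainders of 1 *)

Section Greedy.
Variables (R : realType) (p : nat) (b : p.-tuple R).
Hypotheses (p_gt0 : (0 < p)%N) (b_base : alternate_base b).

(** The remainder before digit n, so that it starts at 1: this is the number
    whose expansion in the base shifted by n is the tail of the digits. *)
Definition greedy_tail (n : nat) : R :=
  if n is m.+1 then greedy_rem b 1 m else 1.

Definition weight (n : nat) : R := \prod_(k < n) (base_at b k)^-1.

Let delta := \prod_(i < p) tnth b i.

Lemma base_at_gt1 n : 1 < base_at b n.
Proof. by have := b_base (Ordinal (ltn_pmod n p_gt0)); rewrite (tnth_nth 0). Qed.

Lemma base_at_gt0 n : 0 < base_at b n.
Proof. exact: lt_trans (base_at_gt1 n). Qed.

Lemma base_atMDl m n : base_at b (p * m + n) = base_at b n.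
Proof. by rewrite /base_at mulnC modnMDl. Qed.

Lemma delta_gt1 : 1 < delta.
Proof.
rewrite /delta; case: p p_gt0 b b_base => // q _ c c_base.
rewrite [ltLHS](_ : _ = \prod_(i < q.+1) (1 : R)); last by rewrite big1_eq.
apply: ltr_prod => [|i _]; last by rewrite ler01 c_base.
by apply/hasP; exists ord0; rewrite ?mem_index_enum.
Qed.

Lemma weightS n : weight n.+1 = weight n / base_at b n.
Proof. by rewrite /weight big_ord_recr. Qed.

Lemma weight_gt0 n : 0 < weight n.
Proof. by apply: prodr_gt0 => k _; rewrite invr_gt0 base_at_gt0. Qed.

Lemma weight_period m n : weight (p * m + n) = weight n / delta ^+ m.
Proof.
elim: m => [|m IHm]; first by rewrite muln0 add0n divr1.
rewrite mulnS -addnA /weight big_split_ord /=.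
have -> : \prod_(i < p) (base_at b i)^-1 = delta^-1.
  rewrite /delta -prodfV; apply: eq_bigr => i _.
  by rewrite /base_at modn_small // (tnth_nth 0).
have per1 k : base_at b (p + k) = base_at b k.
  by have := base_atMDl 1 k; rewrite muln1.
under eq_bigr => k _ do rewrite per1.
by rewrite -/(weight _) IHm exprS invfM mulrCA.
Qed.

Lemma greedy_tailS n :
  greedy_tail n.+1 = base_at b n * greedy_tail n - (expansion b 1 n)%:~R.
Proof. by case: n. Qed.

Lemma greedy_tail_itv n : 0 <= greedy_tail n <= 1.
Proof.
case: n => [|n]; first by rewrite ler01 lexx.
rewrite greedy_tailS /expansion -/(greedy_tail n); set y := _ * _.
have /andP[le_y lt_y] := floor_itv y; rewrite intrD in lt_y.
by rewrite subr_ge0 le_y lerBlDl ltW.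
Qed.

Lemma expansion_ge0 n : 0 <= expansion b 1 n.
Proof.
have /andP[tail_ge0 _] := greedy_tail_itv n.
by rewrite floor_ge0 mulr_ge0 // ltW ?base_at_gt0.
Qed.

Lemma expansion0_gt0 : 0 < expansion b 1 0.
Proof. by rewrite /expansion mulr1 floor_gt0 ltW ?base_at_gt1. Qed.

(** Multiplied by the weights, the recursion for the remainders telescopes. *)
Lemma greedy_tail_weight n :
  greedy_tail n * weight n
    = 1 - \sum_(k < n) (expansion b 1 k)%:~R * weight k.+1.
Proof.
elim: n => [|n IHn]; first by rewrite big_ord0 subr0 /weight big_ord0 mulr1.
rewrite big_ord_recr opprD addrA -IHn greedy_tailS weightS.
by field; rewrite gt_eqF ?base_at_gt0.
Qed.

(** Equal future digits make the difference of the two remainders satisfy the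
    homogeneous recursion, so it grows by delta every p steps; as remainders
    lie in [0, 1], it must be zero. *)
Lemma greedy_tail_period N L :
    (forall n, (N <= n)%N -> expansion b 1 (p * L + n) = expansion b 1 n) ->
  greedy_tail (p * L + N) = greedy_tail N.
Proof.
move=> eper; pose g n := greedy_tail (p * L + n) - greedy_tail n.
have g_le n : `|g n| <= 1.
  have := greedy_tail_itv n; have := greedy_tail_itv (p * L + n).
  by rewrite /g ler_norml; lra.
have gw m : g (m + N)%N * weight (m + N) = g N * weight N.
  elim: m => [//|m <-]; rewrite /g addSn addnS !greedy_tailS base_atMDl.
  rewrite eper ?leq_addl // weightS.
  by field; rewrite gt_eqF ?base_at_gt0.
have bound m : delta ^+ m * `|g N| <= 1.
  have d_gt0 : 0 < delta ^+ m by rewrite exprn_gt0 // (lt_trans _ delta_gt1).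
  have := gw (p * m)%N; rewrite weight_period => gwE.
  have -> : delta ^+ m * `|g N| = `|g (p * m + N)%N|; last exact: g_le.
  rewrite -[delta ^+ m](gtr0_norm d_gt0) -normrM; congr `|_|.
  apply: (mulIf (lt0r_neq0 (weight_gt0 N))); rewrite -mulrA -gwE.
  by field; rewrite gt_eqF.
apply/eqP; rewrite -subr_eq0 -normr_eq0 -/(g N); apply: contraT => gN_neq0.
have gN_gt0 : 0 < `|g N| by rewrite lt_def gN_neq0 normr_ge0.
have bernoulli m : 1 + m%:R * (delta - 1) <= delta ^+ m.
  elim: m => [|m IHm]; first by rewrite mul0r addr0.
  have m_ge0 : 0 <= m%:R * (delta - 1) ^+ 2 by rewrite mulr_ge0 ?sqr_ge0.
  have := ler_wpM2l (ltW (lt_trans ltr01 delta_gt1)) IHm.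
  by rewrite exprS -natr1; lra.
have den_gt0 : 0 < (delta - 1) * `|g N| by rewrite mulr_gt0 // subr_gt0 delta_gt1.
have := archi_boundP (ltW (divr_gt0 ltr01 den_gt0)).
set m := Num.bound _; rewrite ltr_pdivrMr // => lt1.
by have := ler_wpM2r (ltW gN_gt0) (bernoulli m); have := bound m; lra.
Qed.

End Greedy.

Lemma base_shift_at (R : realType) (p : nat) (b : p.-tuple R) (i n : nat) :
  (0 < p)%N -> base_at (base_shift b i) n = base_at b (i + n).
Proof.
move=> p_gt0; have lt_n := ltn_pmod n p_gt0; rewrite {1}/base_at.
rewrite -[X in _`_X]/(val (Ordinal lt_n)) -tnth_nth tnth_mktuple.
by rewrite /base_at /= modnDmr.
Qed.

Lemma weight_shift (R : realType) (p : nat) (b : p.-tuple R) (i n : nat) :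
  (0 < p)%N -> weight b (i + n) = weight b i * weight (base_shift b i) n.
Proof.
move=> p_gt0; rewrite /weight big_split_ord; congr (_ * _).
by apply: eq_bigr => k _; rewrite base_shift_at.
Qed.

(** Multiplying the period by p makes it compatible with the period of the
    base. *)
Lemma eventually_periodic_multiple (T : Type) (w : nat -> T) (p : nat) :
  eventually_periodic w ->
  exists N L, (0 < L)%N /\ forall n, (N <= n)%N -> w (p * L + n)%N = w n.
Proof.
case=> u [v [v_gt0 wE]]; exists (size u), (size v); split=> // n le_un.
rewrite wE [RHS]wE /uv_omega !ltnNge le_un (leq_trans le_un (leq_addl _ _)) /=.
by rewrite -addnBA // modnMDl.
Qed.

Lemma alternate_base_shift (R : realType) (p : nat) (p_gt0 : (0 < p)%N)
    (b : p.-tuple R) (i : nat) :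
  alternate_base b -> alternate_base (base_shift b i).
Proof. by move=> b_base j; rewrite tnth_mktuple base_at_gt1. Qed.

Lemma greedy_tail_return (R : realType) (p : nat) (p_gt0 : (0 < p)%N)
    (b : p.-tuple R) : alternate_base b -> eventually_periodic (expansion b 1) ->
  exists KL : nat * nat, [/\ (0 < KL.1)%N, (0 < KL.2)%N
    & greedy_tail b (p * (KL.2 + KL.1)) = greedy_tail b (p * KL.1)].
Proof.
move=> b_base /(eventually_periodic_multiple p) [N [L [L_gt0 eper]]].
(* Position p * N.+1 is a positive multiple of p beyond the preperiod N. *)
exists (N.+1, L); split=> //=; rewrite mulnDr.
by apply: greedy_tail_period => // n le_n; apply: eper; nia.
Qed.

(** * The linear system of an eventually periodic family of expansions *)

Section PeriodicSystem.
Variables (R : realFieldType) (p : nat) (p_gt0 : (0 < p)%N) (d : R).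
Variables (e : 'I_p -> nat -> int) (K L : 'I_p -> nat).

Definition residue (m : nat) : 'I_p := Ordinal (ltn_pmod m p_gt0).

(** Extends a row by the rule v_(m+p) = v_m / d that the weights obey. *)
Definition scaled_ext (v : 'rV[R]_p) (m : nat) : R :=
  v 0 (residue m) / d ^+ (m %/ p).

(** On the row of weights this is the remainder before digit n, times the
    weight of index i + n; as a linear form it makes sense on every row. *)
Definition tail_form (v : 'rV[R]_p) (i : 'I_p) (n : nat) : R :=
  v 0 i - \sum_(k < n) (e i k)%:~R * scaled_ext v (i + k).+1.

(** Column i holds the coefficients of d ^+ N i times the form of length
    p * N i, as polynomials in d.  Equations are columns because they act on
    row vectors; the matrix of top coefficients is then lower triangular. *)
Definition tail_mx (N : 'I_p -> nat) : 'M[{poly int}]_p :=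
  \matrix_(j, i) ((j == i)%:R *: 'X^(N i)
    - \sum_(k < p * N i | residue (i + k).+1 == j)
        e i k *: 'X^(N i - (i + k).+1 %/ p)).

Lemma scaled_ext_ord v (i : 'I_p) : scaled_ext v i = v 0 i.
Proof.
rewrite /scaled_ext divn_small // divr1; congr (v 0 _).
by apply: val_inj; rewrite /= modn_small.
Qed.

Lemma scaled_extB v w m : scaled_ext (v - w) m = scaled_ext v m - scaled_ext w m.
Proof. by rewrite /scaled_ext !mxE mulrBl. Qed.

Lemma scaled_extZ a v m : scaled_ext (a *: v) m = a * scaled_ext v m.
Proof. by rewrite /scaled_ext !mxE mulrA. Qed.

Lemma tail_formB v w i n : tail_form (v - w) i n = tail_form v i n - tail_form w i n.
Proof.
rewrite /tail_form !mxE.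
under eq_bigr => k _ do rewrite scaled_extB mulrBr.
by rewrite sumrB; ring.
Qed.

Lemma tail_formZ a v i n : tail_form (a *: v) i n = a * tail_form v i n.
Proof.
rewrite /tail_form !mxE mulrBr mulr_sumr; congr (_ - _).
by apply: eq_bigr => k _; rewrite scaled_extZ mulrCA.
Qed.

Lemma tail_mx_index N (i : 'I_p) (k : 'I_(p * N i)) : ((i + k).+1 %/ p <= N i)%N.
Proof.
rewrite -ltnS ltn_divLR // mulSn.
by have := ltn_ord i; have := ltn_ord k; lia.
Qed.

Lemma size_tail_mx N i j : (size (tail_mx N i j) <= (N j).+1)%N.
Proof.
rewrite mxE; apply: leq_trans (size_polyD _ _) _; rewrite size_polyN geq_max.
apply/andP; split.
  by apply: leq_trans (size_scale_leq _ _) _; rewrite size_polyXn.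
apply: leq_trans (size_sum _ _ _) _; apply/bigmax_leqP => k _.
apply: leq_trans (size_scale_leq _ _) _.
by rewrite size_polyXn ltnS leq_subr.
Qed.

(** An index (j + k).+1 exceeds j, so it can be congruent to some i <= j only
    after wrapping around p at least once, which lowers the degree. *)
Lemma coef_tail_mx N (i j : 'I_p) :
  (i <= j)%N -> (tail_mx N i j)`_(N j) = (i == j)%:R.
Proof.
move=> le_ij; rewrite mxE coefB coefZ coefXn eqxx mulr1 coef_sum big1 ?subr0 //.
move=> k /eqP/(congr1 val) /= res_i; rewrite coefZ coefXn.
have := tail_mx_index k; have := divn_eq (j + k).+1 p; rewrite res_i.
case: (_ %/ p)%N => [|t]; first by rewrite mul0n; lia.
by move=> _ lt_t; case: eqP => [|_]; [lia | rewrite mulr0].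
Qed.

Definition period_mx : 'M[{poly int}]_p :=
  tail_mx (fun i => L i + K i)%N - tail_mx K.

Lemma det_period_mx_monic :
  (forall i, (0 < L i)%N) -> \det period_mx \is monic.
Proof.
move=> L_gt0; have coefK i j : (tail_mx K i j)`_(L j + K j) = 0.
  rewrite nth_default //; apply: leq_trans (size_tail_mx _ _ _) _.
  by have := L_gt0 j; lia.
have entryE i j : period_mx i j
    = tail_mx (fun i => L i + K i)%N i j - tail_mx K i j.
  by rewrite [LHS]mxE [X in _ + X]mxE.
apply: (@det_monic_of_trig _ _ _ (fun i => L i + K i)%N) => [i j|i j lt_ij|i].
- rewrite entryE; apply: leq_trans (size_polyD _ _) _.
  rewrite size_polyN geq_max size_tail_mx (leq_trans (size_tail_mx _ _ _)) //.
  by rewrite ltnS leq_addl.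
- rewrite entryE coefB coefK subr0.
  by rewrite (coef_tail_mx _ (ltnW lt_ij)) -val_eqE ltn_eqF.
- by rewrite entryE coefB coefK subr0 coef_tail_mx ?eqxx.
Qed.

Section Evaluation.
Hypothesis d_gt1 : 1 < d.

Lemma mul_tail_mx (v : 'rV[R]_p) N i :
  (v *m map_mx (horner_eval d \o map_poly intr) (tail_mx N)) 0 i
    = d ^+ N i * tail_form v i (p * N i).
Proof.
have d_neq0 : d != 0 by rewrite gt_eqF // (lt_trans ltr01).
rewrite mxE /tail_form mulrBr mulr_sumr.
under eq_bigr => j _.
  rewrite !mxE raddfB mulrBr /=.
  over.
rewrite sumrB; congr (_ - _).
  rewrite (bigD1 i) //= eqxx scale1r big1 ?addr0 => [|j /negPf->].
    by rewrite /horner_eval map_polyXn hornerXn mulrC.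
  by rewrite scale0r rmorph0 /horner_eval horner0 mulr0.
rewrite [RHS](partition_big (fun k : 'I__ => residue (i + k).+1) xpredT) //=.
apply: eq_bigr => j _; rewrite !rmorph_sum mulr_sumr /=.
apply: eq_bigr => k /eqP res_j.
rewrite /horner_eval map_polyZ /= map_polyXn hornerZ hornerXn.
have dN : d ^+ N i = d ^+ (N i - (i + k).+1 %/ p) * d ^+ ((i + k).+1 %/ p).
  by rewrite -exprD subnK // tail_mx_index.
rewrite /scaled_ext res_j [X in _ = X * _]dN.
by field; rewrite expf_neq0.
Qed.

Hypotheses (K_gt0 : forall i, (0 < K i)%N) (L_gt0 : forall i, (0 < L i)%N).
Hypotheses (e_ge0 : forall i k, 0 <= e i k) (e0_gt0 : forall i, 0 < e i 0).

Definition period_eq (v : 'rV[R]_p) (i : 'I_p) : Prop :=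
  d ^+ (L i + K i) * tail_form v i (p * (L i + K i))
    = d ^+ K i * tail_form v i (p * K i).

Lemma mul_period_mx v i :
  (v *m map_mx (horner_eval d \o map_poly intr) period_mx) 0 i
    = d ^+ (L i + K i) * tail_form v i (p * (L i + K i))
      - d ^+ K i * tail_form v i (p * K i).
Proof. by rewrite map_mxB mulmxBr mxE [X in _ + X]mxE !mul_tail_mx. Qed.

Lemma scaled_ext_ge0 (v : 'rV[R]_p) m :
  (forall i, 0 <= v 0 i) -> 0 <= scaled_ext v m.
Proof.
by move=> v_ge0; rewrite divr_ge0 // exprn_ge0 // ltW // (lt_trans ltr01).
Qed.

(** If w_i = 0, the form at i is minus a sum s_n of nonnegative terms,
    nondecreasing in n, and the equation reads d^L s_(p (L + K)) = s_(p K).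
    With d^L > 1 this forces both sums to vanish, in particular the term of
    the leading digit, which contains w_(i+1). *)
Lemma zero_propagates (w : 'rV[R]_p) (i : 'I_p) :
    (forall j, 0 <= w 0 j) -> period_eq w i ->
  w 0 i = 0 -> scaled_ext w i.+1 = 0.
Proof.
move=> w_ge0 weq wi0.
have term_ge0 k : 0 <= (e i k)%:~R * scaled_ext w (i + k).+1.
  by rewrite mulr_ge0 ?ler0z ?scaled_ext_ge0.
set s := fun n => \sum_(k < n) (e i k)%:~R * scaled_ext w (i + k).+1.
have sE n : tail_form w i n = - s n by rewrite /tail_form wi0 sub0r.
have s_ge0 n : 0 <= s n by apply: sumr_ge0.
have s_mono : s (p * K i)%N <= s (p * (L i + K i))%N.
  by rewrite mulnDr addnC /s big_split_ord /= lerDl sumr_ge0.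
have dK_gt0 : 0 < d ^+ K i by rewrite exprn_gt0 // (lt_trans ltr01).
have dL_gt1 : 1 < d ^+ L i by rewrite exprn_egt1 // -lt0n.
have sK0 : s (p * K i)%N = 0.
  move: weq; rewrite /period_eq !sE exprD [_ * d ^+ K i]mulrC -mulrA.
  move/(mulfI (lt0r_neq0 dK_gt0)) => sLE.
  have := s_ge0 (p * K i)%N; nra.
have : (e i 0)%:~R * scaled_ext w i.+1 <= 0.
  have pK : (p * K i)%N = (p * K i).-1.+1.
    by rewrite prednK // muln_gt0 p_gt0 K_gt0.
  move: sK0; rewrite /s pK big_ord_recl /= addn0 => <-.
  by rewrite lerDl sumr_ge0.
rewrite pmulr_rle0 ?ltr0z // => le0.
by apply/eqP; rewrite eq_le le0 scaled_ext_ge0.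
Qed.

(** Zeros move from i up to p, and position p is position 0 rescaled. *)
Lemma zero_reaches_origin (w : 'rV[R]_p) (i : 'I_p) : (forall j, 0 <= w 0 j) ->
    (forall j : 'I_p, (0 < j)%N -> period_eq w j) ->
  w 0 i = 0 -> w 0 (residue 0) = 0.
Proof.
move=> w_ge0 weq wi0; have [i0|i_gt0] := posnP i.
  by rewrite -wi0; congr (w 0 _); apply: val_inj; rewrite /= mod0n.
have reach k : (i + k <= p)%N -> scaled_ext w (i + k) = 0.
  elim: k => [_|k IHk]; first by rewrite addn0 scaled_ext_ord.
  rewrite addnS => lt_p; have /= := @zero_propagates w (Ordinal lt_p) w_ge0.
  apply; first by apply: weq; rewrite /= addn_gt0 i_gt0.
  by rewrite -scaled_ext_ord IHk // ltnW.
have := reach (p - i)%N; rewrite subnKC ?(ltnW (ltn_ord i)) // => /(_ (leqnn _))/eqP.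
rewrite /scaled_ext mulf_eq0 invr_eq0 expf_eq0 [d == 0]gt_eqF ?(lt_trans ltr01) //.
rewrite andbF orbF => /eqP <-; congr (w 0 _).
by apply: val_inj; rewrite /= modnn mod0n.
Qed.

Variable x : 'rV[R]_p.
Hypotheses (x_gt0 : forall i, 0 < x 0 i) (x_eq : forall i, period_eq x i).

(** Maximum principle: with a the largest ratio z_j / x_j, the row a x - z is
    nonnegative and vanishes where the maximum is attained, hence also at 0.
    There it equals a x_0, so a = 0. *)
Lemma period_sol_le0 (z : 'rV[R]_p) :
    (forall j : 'I_p, (0 < j)%N -> period_eq z j) ->
  z 0 (residue 0) = 0 -> forall i, z 0 i <= 0.
Proof.
move=> zeq z0 i.
have [m _ m_max] := arg_maxP (fun j => z 0 j / x 0 j) (isT : xpredT (residue 0)).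
pose a := z 0 m / x 0 m; pose w := a *: x - z.
have w_ge0 j : 0 <= w 0 j.
  by rewrite !mxE subr_ge0 -ler_pdivrMr //; apply: m_max.
have wm : w 0 m = 0 by rewrite !mxE divfK ?subrr // gt_eqF.
have weq (j : 'I_p) : (0 < j)%N -> period_eq w j.
  move=> j_gt0; rewrite /period_eq !tail_formB !tail_formZ.
  rewrite mulrBr [RHS]mulrBr (zeq j j_gt0); congr (_ - _).
  by rewrite mulrCA [RHS]mulrCA; congr (_ * _); apply: x_eq.
have := zero_reaches_origin w_ge0 weq wm; rewrite !mxE z0 subr0 => /eqP.
rewrite mulf_eq0 orbC gt_eqF //= => /eqP a0.
by have := w_ge0 i; rewrite !mxE a0 mul0r sub0r oppr_ge0.
Qed.

Lemma period_sol_eq0 (z : 'rV[R]_p) :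
    (forall j : 'I_p, (0 < j)%N -> period_eq z j) ->
  z 0 (residue 0) = 0 -> z = 0.
Proof.
move=> zeq z0; apply/rowP => i; rewrite mxE; apply/eqP; rewrite eq_le.
rewrite period_sol_le0 //=.
suff : (- z) 0 i <= 0 by rewrite mxE oppr_le0.
apply: period_sol_le0 => [j /zeq zE|]; last by rewrite mxE z0 oppr0.
rewrite /period_eq -scaleN1r !tail_formZ.
by rewrite mulrCA [RHS]mulrCA; congr (_ * _); apply: zE.
Qed.

Lemma det_period_root : root (map_poly intr (\det period_mx)) d.
Proof.
pose ev : {rmorphism {poly int} -> R} := horner_eval d \o map_poly intr.
rewrite rootE -[_.[d]]/(ev (\det period_mx)).
rewrite -det_map_mx; apply/det0P; exists x.
  by apply/eqP => /rowP/(_ (residue 0)) /eqP; rewrite mxE gt_eqF.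
by apply/rowP => i; rewrite mul_period_mx x_eq subrr mxE.
Qed.

Lemma period_sol_in_divring (F : divringClosed R) :
  d \in F -> x 0 (residue 0) = 1 -> forall i, x 0 i \in F.
Proof.
move=> dF x0; set ev := horner_eval d \o map_poly intr.
(* Equation 0 is replaced by the coordinate at 0, whose value on x is 1. *)
pose A := \matrix_(j, i) (if i == residue 0 then (j == residue 0)%:R
                          else map_mx ev period_mx j i).
have mulA v i : (v *m A) 0 i = if i == residue 0 then v 0 (residue 0)
    else (v *m map_mx ev period_mx) 0 i.
  rewrite mxE; under eq_bigr do rewrite mxE.
  case: eqP => _; last by rewrite [RHS]mxE.
  rewrite (bigD1 (residue 0)) //= eqxx mulr1 big1 ?addr0 // => j /negPf->.
  by rewrite mulr0.
apply: (@solution_in_divring _ F _ A).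
- rewrite unitmxE unitfE; apply/det0P => -[z /eqP z_neq0 zA]; case: z_neq0.
  have zA0 i : (z *m A) 0 i = 0 by rewrite zA mxE.
  apply: period_sol_eq0 => [j j_gt0|].
    have := zA0 j; rewrite mulA -val_eqE /= mod0n gtn_eqF // mul_period_mx.
    by move/eqP; rewrite subr_eq0 => /eqP.
  by have := zA0 (residue 0); rewrite mulA eqxx.
- move=> i j; rewrite mxE; case: ifP => _; first exact: rpred_nat.
  by rewrite mxE; apply: horner_in_divring.
- move=> j; rewrite mulA; case: ifP => _; first by rewrite x0 rpred1.
  by rewrite mul_period_mx x_eq subrr rpred0.
Qed.

End Evaluation.
End PeriodicSystem.

(** * Integrality of delta and the field generated by it *)

Theorem theorem14 (R : realType) (p : nat) (p_gt0 : (0 < p)%N)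
    (beta : p.-tuple R) (beta_base : alternate_base beta)
    (beta_per : forall i : 'I_p,
       eventually_periodic (expansion (base_shift beta i) 1)) :
  let delta := \prod_(i < p) tnth beta i in
  algebraic_integer delta /\
  (forall i : 'I_p, in_Qadjoin delta (tnth beta i)).
Proof.
move=> delta; have d_gt1 : 1 < delta := delta_gt1 p_gt0 beta_base.
have d_neq0 : delta != 0 by rewrite gt_eqF // (lt_trans ltr01).
have shift_base i : alternate_base (base_shift beta i) by apply: alternate_base_shift.
pose e (i : 'I_p) := expansion (base_shift beta i) 1.
have e_ge0 i k : 0 <= e i k by apply: expansion_ge0.
have e0_gt0 i : 0 < e i 0 by apply: expansion0_gt0.
have [KL KL_P] := fin_all_exists (fun i : 'I_p =>
  greedy_tail_return p_gt0 (shift_base i) (beta_per i)).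
pose K i := (KL i).1; pose L i := (KL i).2.
have K_gt0 i : (0 < K i)%N by case: (KL_P i).
have L_gt0 i : (0 < L i)%N by case: (KL_P i).
pose x : 'rV[R]_p := \row_i weight beta i.
have x_gt0 i : 0 < x 0 i by rewrite mxE weight_gt0.
have extE m : scaled_ext p_gt0 delta x m = weight beta m.
  by rewrite /scaled_ext mxE -weight_period // mulnC -divn_eq.
have tailE (i : 'I_p) N : delta ^+ N * tail_form p_gt0 delta e x i (p * N)
    = weight beta i * greedy_tail (base_shift beta i) (p * N).
  have -> : tail_form p_gt0 delta e x i (p * N)
      = greedy_tail (base_shift beta i) (p * N) * weight beta (p * N + i).
    rewrite addnC weight_shift // mulrCA greedy_tail_weight //.
    rewrite /tail_form mxE mulrBr mulr1 mulr_sumr; congr (_ - _).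
    by apply: eq_bigr => k _; rewrite extE -addnS weight_shift // mulrCA.
  by rewrite weight_period //; field; rewrite expf_neq0.
have x_eq i : period_eq p_gt0 delta e K L x i.
  by rewrite /period_eq !tailE; case: (KL_P i) => _ _ ->.
split.
  exists (\det (period_mx p_gt0 e K L)); first exact: det_period_mx_monic L_gt0.
  exact: (det_period_root _ x_gt0).
move=> i F dF.
have xF m : weight beta m \in F.
  rewrite -extE rpred_div ?rpredX //.
  apply: (period_sol_in_divring d_gt1 K_gt0 L_gt0 e_ge0 e0_gt0 x_gt0 x_eq) => //.
  by rewrite mxE /= mod0n /weight big_ord0.
have -> : tnth beta i = weight beta i / weight beta i.+1.
  rewrite weightS /base_at modn_small // -tnth_nth invfM invrK mulrA divff ?mul1r //.
  by rewrite gt_eqF ?weight_gt0.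
by rewrite rpred_div.
Qed.
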